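(* Consider the generalized linear model described in the context and assume that Assumptions A.1, A.2, A.3 stated there hold, with $F$, $\mathcal{X}$, $\varkappa>0$, $M$ as in these assumptions. Let $x\in\mathcal{X}$ be an arbitrary signal, and let $\omega_k=(\eta_k,y_k)$, $k=1,2,\dots$, be i.i.d. observations drawn from $P_x$. Let $z_0\in\mathcal{X}$ be a fixed (deterministic) point, and let $z_k$ be given by the Stochastic Approximation recurrence $$z_k=\mathrm{Proj}_{\mathcal{X}}\left[z_{k-1}-\gamma_k\left(\eta_kf(\eta_k^Tz_{k-1})-\eta_ky_k\right)\right],\quad k=1,2,\dots,$$ with the stepsizes $$\gamma_k=[\varkappa(k+1)]^{-1},\quad k=1,2,\dots$$ Then the estimates $\widehat{x}_k(\omega^k)=z_k$, where $\omega^k=(\omega_1,\dots,\omega_k)$, obey for every $k$ the error bound $$\mathbf{E}_{\omega^k\sim P_x^k}\left\{\|\widehat{x}_k(\omega^k)-x\|_2^2\right\}\le\frac{4M^2}{\varkappa^2(k+1)},\quad k=0,1,\dots,$$ where $P_x^k=P_x\times\cdots\times P_x$ ($k$ factors) is the distribution of $\omega^k$.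
   Context: Generalized linear model: $m,n$ are positive integers, $\mathcal{X}\subset\mathbf{R}^n$ is a given set of signals, and $f:\mathbf{R}^m\to\mathbf{R}^m$ is a given mapping. For each signal $x\in\mathcal{X}$, $P_x$ is a probability distribution of a random pair $\omega=(\eta,y)$ such that: (i) the regressor $\eta$ is a random $n\times m$ matrix whose (marginal) probability distribution $Q$ does not depend on $x$; (ii) the label $y$ is an $m$-dimensional random vector whose conditional expectation given $\eta$, under $P_x$, is $\mathbf{E}^x_{|\eta}\{y\}=f(\eta^Tx)$. Monotonicity: a vector field $g:\mathbf{R}^d\to\mathbf{R}^d$ is monotone if $[g(z)-g(z')]^T[z-z']\ge 0$ for all $z,z'\in\mathbf{R}^d$; it is monotone with modulus $\varkappa\ge0$ on a closed convex set $Z\subset\mathbf{R}^d$ if $[g(z)-g(z')]^T[z-z']\ge\varkappa\|z-z'\|_2^2$ for all $z,z'\in Z$. Assumptions: A.1. The vector field $f$ is continuous and monotone, and the vector field $F(z)=\mathbf{E}_{\eta\sim Q}\{\eta f(\eta^Tz)\}$ is well defined for all $z\in\mathbf{R}^n$ (i.e., the expectation exists and is finite; $F$ is then monotone). A.2. $\mathcal{X}$ is a nonempty convex compact set, and $F$ is monotone with positive modulus $\varkappa$ on $\mathcal{X}$. A.3. $M<\infty$ is such that $\mathbf{E}_{(\eta,y)\sim P_x}\{\|\eta y\|_2^2\}\le M^2$ for every $x\in\mathcal{X}$. Projection: $\mathrm{Proj}_{\mathcal{X}}[z]=\mathrm{argmin}_{u\in\mathcal{X}}\|z-u\|_2$ is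 the metric projection of $\mathbf{R}^n$ onto $\mathcal{X}$. *)

(* Defs.v *)
From HB Require Import structures.
From mathcomp Require Import all_boot all_order all_algebra.
From mathcomp Require Import all_classical all_reals all_analysis.

Set Implicit Arguments.
Unset Strict Implicit.
Unset Printing Implicit Defensive.

Import Order.TTheory GRing.Theory Num.Theory.
Import numFieldNormedType.Exports.

Local Open Scope classical_set_scope.
Local Open Scope ring_scope.

(* The library norm `|_| on matrices is the sup norm, hence the Euclidean
   structure is set up here. *)
Definition dotp (R : realType) (d : nat) (u v : 'cV[R]_d) : R :=
  (u^T *m v) ord0 ord0.

Definition norm2 (R : realType) (d : nat) (u : 'cV[R]_d) : R :=
  Num.sqrt (dotp u u).

Definition monotone_field (R : realType) (d : nat) (g : 'cV[R]_d -> 'cV[R]_d) :=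
  forall z z', 0 <= dotp (g z - g z') (z - z').

Definition monotone_modulus (R : realType) (d : nat) (kappa : R)
    (Z : set 'cV[R]_d) (g : 'cV[R]_d -> 'cV[R]_d) :=
  forall z z', Z z -> Z z' ->
    kappa * norm2 (z - z') ^+ 2 <= dotp (g z - g z') (z - z').

(* When X is nonempty, closed and convex the minimizer exists and is unique;
   the default value z is used only when there is no minimizer. *)
Definition Proj (R : realType) (d : nat) (X : set 'cV[R]_d) (z : 'cV[R]_d) :
    'cV[R]_d :=
  xget z [set u | X u /\ forall v, X v -> norm2 (z - u) <= norm2 (z - v)].

(* Matrices with their Borel sigma-algebra. *)
Definition borelM (R : realType) (p q : nat) :=
  g_sigma_algebraType (@open 'M[R]_(p, q)).

(* A pair (eta, y): the n x m regressor and the label in R^m. *)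
Definition obs (R : realType) (n m : nat) :=
  (borelM R n m * borelM R m 1)%type.

(* g \o eta is a version of the conditional expectation E[Y | eta].  As usual
   for conditional expectations in the extended sense, Y is not required to be
   integrable but only such that E[|Y| | eta] < +oo almost surely, i.e.,
   integrable over each piece of a countable cover by events of sigma(eta).
   For integrable Y this is Kolmogorov's definition, see
   [cond_expectation_integrable]. *)
Definition cond_expectation (d d' : measure_display) (T : measurableType d)
    (T' : measurableType d') (R : realType) (P : probability T R)
    (eta : T -> T') (Y : T -> R) (g : T' -> R) : Prop :=
  [/\ measurable_fun setT g,
      exists B : (set T')^nat,
        [/\ forall i, measurable (B i), \bigcup_i B i = setT &
            forall i, P.-integrable (eta @^-1` B i) (EFin \o Y)] &
      forall B : set T', measurable B ->
        P.-integrable (eta @^-1` B) (EFin \o Y) ->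
        (\int[P]_(w in eta @^-1` B) (Y w)%:E =
         \int[P]_(w in eta @^-1` B) (g (eta w))%:E)%E].

Lemma cond_expectation_integrable (d d' : measure_display)
    (T : measurableType d) (T' : measurableType d') (R : realType)
    (P : probability T R) (eta : T -> T') (Y : T -> R) (g : T' -> R) :
  measurable_fun setT eta -> P.-integrable setT (EFin \o Y) ->
  cond_expectation P eta Y g <->
  measurable_fun setT g /\
  forall B : set T', measurable B ->
    (\int[P]_(w in eta @^-1` B) (Y w)%:E =
     \int[P]_(w in eta @^-1` B) (g (eta w))%:E)%E.
Proof.
move=> meta iY.
have iYB (B : set T') : measurable B ->
    P.-integrable (eta @^-1` B) (EFin \o Y).
  move=> mB; apply: (integrableS (E := setT)) => //.
  by rewrite -[_ @^-1` _]setTI; exact: meta.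
split=> [[mg _ E]|[mg E]].
  by split=> // B mB; apply: E => //; exact: iYB.
split=> //; last by move=> B mB _; exact: E.
exists (fun=> setT); split=> [i||i].
- exact: measurableT.
- by rewrite bigcup_const.
- by rewrite preimage_setT.
Qed.

Definition rcons_tuple_pair (T : Type) (k : nat) (p : k.-tuple T * T) :
  k.+1.-tuple T := [tuple of rcons p.1 p.2].

Lemma measurable_rcons_tuple_pair (d : measure_display) (T : measurableType d)
    (k : nat) : measurable_fun setT (@rcons_tuple_pair T k).
Proof.
apply/measurable_fun_tnthP => i.
have [ik|ik] := ltnP i k.
  rewrite (_ : _ \o _ = (fun t => tnth t (Ordinal ik)) \o fst); last first.
    apply/funext => -[t a] /=.
    by rewrite !(tnth_nth a) /= nth_rcons size_tuple ik.
  by apply: measurableT_comp => //; exact: measurable_tnth.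
rewrite (_ : _ \o _ = snd)//; apply/funext => -[t a] /=.
rewrite (tnth_nth a) /= nth_rcons size_tuple ltnNge ik /=.
have -> : i = k :> nat by apply/eqP; rewrite eqn_leq ik -ltnS ltn_ord.
by rewrite eqxx.
Qed.

HB.instance Definition _ (d : measure_display) (T : measurableType d)
    (k : nat) :=
  isMeasurableFun.Build _ _ _ _ (@rcons_tuple_pair T k)
    (@measurable_rcons_tuple_pair d T k).

(* The product measure P x ... x P (k factors) on k-tuples. *)
Fixpoint power_prob (d : measure_display) (T : measurableType d)
    (R : realType) (P : probability T R) (k : nat) :
    probability (k.-tuple T) R :=
  match k with
  | 0 => \d_([tuple] : 0.-tuple T)
  | k'.+1 => distribution (power_prob P k' \x P)%E (@rcons_tuple_pair T k')
  end.

Lemma power_prob_box (d : measure_display) (T : measurableType d)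
    (R : realType) (P : probability T R) (k : nat) (A : 'I_k -> set T) :
  (forall i, measurable (A i)) ->
  (power_prob P k [set t | forall i, A i (tnth t i)] = \prod_(i < k) P (A i))%E.
Proof.
elim: k A => [|k IHk] A mA.
  by rewrite big_ord0 /= diracE mem_set// => -[].
rewrite big_ord_recr /= -IHk; last by move=> i; exact: mA.
have mB : measurable [set t : k.-tuple T |
    forall i, A (widen_ord (leqnSn k) i) (tnth t i)].
  rewrite (_ : mkset _ = \bigcap_(i in [set: 'I_k])
      ((fun t : k.-tuple T => tnth t i) @^-1` A (widen_ord (leqnSn k) i))).
    apply: fin_bigcap_measurable => // i _.
    by rewrite -[_ @^-1` _]setTI; exact: measurable_tnth.
  by apply/seteqP; split=> [t At i _|t At i]; exact: At.
rewrite -product_measure1E// /pushforward /=; congr (_ _).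
apply/seteqP; split=> -[t a] /= tA.
  split=> [i|].
    have := tA (widen_ord (leqnSn k) i).
    by rewrite !(tnth_nth a) /= nth_rcons size_tuple ltn_ord.
  by have := tA ord_max; rewrite (tnth_nth a) /= nth_rcons size_tuple ltnn eqxx.
case: tA => tA aA i; have [ik|ik] := ltnP i k.
  have := tA (Ordinal ik); rewrite !(tnth_nth a) /= nth_rcons size_tuple ik.
  by rewrite (_ : widen_ord _ _ = i)//; exact/val_inj.
have -> : i = ord_max.
  by apply/val_inj/eqP; rewrite /= eqn_leq ik -ltnS ltn_ord.
by rewrite (tnth_nth a) /= nth_rcons size_tuple ltnn eqxx.
Qed.

Definition regression_field (R : realType) (n m : nat)
    (Q : probability (borelM R n m) R) (f : 'cV[R]_m -> 'cV[R]_m)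
    (z : 'cV[R]_n) : 'cV[R]_n :=
  \col_i \int[Q]_eta ((eta *m f (eta^T *m z)) i ord0).

Definition stepsize (R : realType) (kappa : R) (k : nat) : R :=
  (kappa * (k%:R + 1))^-1.

(* Observations are indexed from 0: w k is the observation omega_{k+1}. *)
Fixpoint SA_iter (R : realType) (n m : nat) (X : set 'cV[R]_n)
    (f : 'cV[R]_m -> 'cV[R]_m) (kappa : R) (z0 : 'cV[R]_n)
    (w : nat -> obs R n m) (k : nat) : 'cV[R]_n :=
  match k with
  | 0 => z0
  | k'.+1 =>
    let z := SA_iter X f kappa z0 w k' in
    let eta : 'M[R]_(n, m) := (w k').1 in
    let y : 'cV[R]_m := (w k').2 in
    Proj X (z - stepsize kappa k'.+1 *: (eta *m f (eta^T *m z) - eta *m y))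
  end.

(* Only the first k observations are used, so the default of nth is
   immaterial. *)
Definition SA_estimate (R : realType) (n m : nat) (X : set 'cV[R]_n)
    (f : 'cV[R]_m -> 'cV[R]_m) (kappa : R) (z0 : 'cV[R]_n) (k : nat)
    (t : k.-tuple (obs R n m)) : 'cV[R]_n :=
  SA_iter X f kappa z0 (nth point t) k.

(* Main.v *)
Require Import Defs.
From HB Require Import structures.
From mathcomp Require Import all_boot all_order all_algebra.
From mathcomp Require Import all_classical all_reals all_analysis.
From mathcomp Require Import measurable_realfun ring lra.
Set Implicit Arguments.
Unset Strict Implicit.
Unset Printing Implicit Defensive.
Import Order.TTheory GRing.Theory Num.Theory.
Import numFieldNormedType.Exports.
Local Open Scope classical_set_scope.
Local Open Scope ring_scope.

(** Write [F z = E (eta *m f (eta^T *m z))] for the regression field,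
    [U z = eta *m f (eta^T *m z)] for its sample at a regressor, and
    [V = eta *m y].  Under [P_x] the conditional expectation of [V] given [eta]
    is [U x], so the noisy direction [U z - V] has mean [F z - F x]: it is an
    unbiased estimate of a strongly monotone field whose zero on [X] is the
    signal [x].  Three facts then give the rate.

    - Second moments.  [U z] is a conditional expectation of [V] under [P_z], so
      [E |U z|^2 <= E_z |V|^2 <= M^2]; the left-hand side depends on the law of
      the regressor only, which is the same under all signals.  This is
      [field_second_moment].  It yields [E |U z - V|^2 <= 4 M^2], and also
      [|z - x|^2 <= 4 M^2 / kappa^2] on [X] ([dotp_diameter]), which is the
      bound at time 0.
    - One step.  The projection onto [X] does not increase the distance to
      [x], so averaging over a fresh observation turns [|z - x|^2] into at most
      [(1 - 2 kappa gamma) |z - x|^2 + 4 gamma^2 M^2]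
      ([integral_SA_step_le]).
    - Recursion.  The last observation is independent of the previous iterate,
      so Tonelli's theorem averages the one-step bound, and with
      [gamma_k = 1 / (kappa (k + 1))] the bound propagates ([SA_rate]).

    The label is assumed integrable only on each piece of a countable cover by
    events determined by the regressor.  The statements about
    [E (V | eta) = U x] are therefore proved on pieces where moreover the
    functions of the regressor that occur are bounded, and then summed over a
    disjoint cover ([integral_centered_eq0], [integral_le_centered]).  For
    Tonelli's theorem the iterates must be measurable functions of the
    observations; since the projection and [f] are continuous, this reduces to
    the fact that measurability into matrices can be tested on entries
    ([measurable_fun_matrix]). *)

(** * Euclidean structure and metric projection *)

Section euclid.
Context (R : realType) (d : nat).
Implicit Types u v w : 'cV[R]_d.

Lemma dotpE u v : dotp u v = \sum_i u i ord0 * v i ord0.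
Proof. by rewrite /dotp mxE; apply: eq_bigr => i _; rewrite mxE. Qed.

Lemma dotpC u v : dotp u v = dotp v u.
Proof. by rewrite !dotpE; apply: eq_bigr => i _; rewrite mulrC. Qed.

Lemma dotpDl u v w : dotp (u + v) w = dotp u w + dotp v w.
Proof. by rewrite /dotp linearD mulmxDl mxE. Qed.

Lemma dotpZl a u v : dotp (a *: u) v = a * dotp u v.
Proof. by rewrite /dotp linearZ -scalemxAl mxE. Qed.

Lemma dotpNl u v : dotp (- u) v = - dotp u v.
Proof. by rewrite -scaleN1r dotpZl mulN1r. Qed.

Lemma dotpDr u v w : dotp w (u + v) = dotp w u + dotp w v.
Proof. by rewrite dotpC dotpDl !(dotpC w). Qed.

Lemma dotpZr a u v : dotp u (a *: v) = a * dotp u v.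
Proof. by rewrite dotpC dotpZl (dotpC u). Qed.

Lemma dotpNr u v : dotp u (- v) = - dotp u v.
Proof. by rewrite dotpC dotpNl (dotpC u). Qed.

Lemma dotpBr u v w : dotp w (u - v) = dotp w u - dotp w v.
Proof. by rewrite dotpDr dotpNr. Qed.

Definition dotp_bilin := (dotpDl, dotpDr, dotpNl, dotpNr, dotpZl, dotpZr).

Lemma dotp_ge0 u : 0 <= dotp u u.
Proof. by rewrite dotpE; apply: sumr_ge0 => i _; rewrite -expr2 sqr_ge0. Qed.

Lemma sqr_norm2 u : norm2 u ^+ 2 = dotp u u.
Proof. by rewrite /norm2 sqr_sqrtr // dotp_ge0. Qed.

Lemma norm2_ge0 u : 0 <= norm2 u.
Proof. exact: sqrtr_ge0. Qed.

Lemma ler_norm2 u v : (norm2 u <= norm2 v) = (dotp u u <= dotp v v).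
Proof. by rewrite -!sqr_norm2 ler_pXn2r // nnegrE norm2_ge0. Qed.

Lemma dotp_sub_scale (t : R) u v :
  dotp (u - t *: v) (u - t *: v) =
  dotp u u - 2 * t * dotp u v + t ^+ 2 * dotp v v.
Proof. by rewrite !dotp_bilin (dotpC v u); ring. Qed.

Lemma dotp_sub_ge u v : dotp u u + 2 * dotp u (v - u) <= dotp v v.
Proof.
by have := dotp_ge0 (v - u); rewrite !dotp_bilin (dotpC v u); lra.
Qed.

Lemma dotp_sub_le u v : dotp (u - v) (u - v) <= 2 * (dotp u u + dotp v v).
Proof.
by have := dotp_ge0 (u + v); rewrite !dotp_bilin (dotpC v u); lra.
Qed.

Lemma normr_dotp_le u v : `|dotp u v| <= dotp u u + dotp v v.
Proof.
have := dotp_ge0 (u - v); have := dotp_ge0 (u + v).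
have := dotp_ge0 u; have := dotp_ge0 v.
by rewrite !dotp_bilin (dotpC v u) ler_norml => *; apply/andP; split; lra.
Qed.

Lemma sqr_entry_le_dotp u i : u i ord0 ^+ 2 <= dotp u u.
Proof.
rewrite dotpE (bigD1 i) //= -expr2 lerDl.
by apply: sumr_ge0 => j _; rewrite -expr2 sqr_ge0.
Qed.

Lemma continuous_dotp_sub v : continuous (fun u => dotp (v - u) (v - u)).
Proof.
under eq_fun do rewrite dotpE.
apply: (@continuous_big R^o _ +%R 0 xpredT) => [|i _ u].
  by move=> x; apply: cvgD; [exact: cvg_fst|exact: cvg_snd].
have fu : Filter (nbhs u) by exact: nbhs_filter.
have c : continuous_at u (fun w : 'cV[R]_d => v i ord0 - w i ord0).
  by apply: cvgB; [exact: cvg_cst|exact: coord_continuous].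
under eq_fun do rewrite !mxE.
exact: (cvgM c c).
Qed.

End euclid.

Lemma dotp_mulmxr (R : realType) (p q : nat) (A : 'M[R]_(p, q))
    (u : 'cV[R]_p) (v : 'cV[R]_q) : dotp u (A *m v) = dotp (A^T *m u) v.
Proof. by rewrite /dotp trmx_mul trmxK mulmxA. Qed.

Section projection.
Context (R : realType) (d : nat) (X : set 'cV[R]_d).
Hypothesis X0 : X !=set0.
Hypothesis Xconv : convex_set (X : set (convex_lmodType 'cV[R]_d)).
Hypothesis Xcomp : compact X.
Implicit Types u v z : 'cV[R]_d.

Lemma Proj_spec z :
  X (Proj X z) /\ forall v, X v -> norm2 (z - Proj X z) <= norm2 (z - v).
Proof.
rewrite /Proj; case: xgetP => [u -> //|no].
have [u Xu umin] : exists2 u, X u &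
    forall v, X v -> dotp (z - u) (z - u) <= dotp (z - v) (z - v).
  have [u /set_mem Xu umin] := @compact_EVT_min _ R
    (fun u => dotp (z - u) (z - u)) X X0 Xcomp
    (continuous_subspaceT (@continuous_dotp_sub R d z)).
  by exists u => // v Xv; apply: umin; rewrite inE.
by case: (no u); split => // v Xv; rewrite ler_norm2 umin.
Qed.

Lemma convex_segment u v (t : R) : X u -> X v -> 0 <= t -> t <= 1 ->
  X (u + t *: (v - u)).
Proof.
move=> Xu Xv t0 t1.
have := @Xconv v u (Itv01 t0 t1); rewrite !inE => /(_ Xv Xu).
suff -> : u + t *: (v - u) = t *: v + (1 - t) *: u by [].
by rewrite scalerBl scale1r scalerBr addrCA.
Qed.

(** First-order optimality: moving from the projection [p] towards [v] inside
    the segment [p, v] cannot decrease the distance to [z]; compare the linear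
    and quadratic terms of the squared distance for a small step. *)
Lemma Proj_variational z v : X v ->
  dotp (z - Proj X z) (v - Proj X z) <= 0.
Proof.
move=> Xv; have [Xp pmin] := Proj_spec z.
set p := Proj X z in Xp pmin *; set a := dotp _ _.
set b := dotp (v - p) (v - p).
have b0 : 0 <= b by exact: dotp_ge0.
rewrite leNgt; apply/negP => a0.
(* The best step is [a / b]; this one also makes sense for [b = 0] and stays
   in the unit interval. *)
pose t := a / (a + b).
have ab : 0 < a + b by rewrite ltr_wpDr.
have t0 : 0 < t by rewrite divr_gt0.
have t1 : t <= 1 by rewrite ler_pdivrMr // mul1r lerDl.
have := pmin _ (convex_segment Xp Xv (ltW t0) t1).
rewrite ler_norm2 opprD addrA dotp_sub_scale -/a -/b => h.
have h2 : 2 * a <= t * b by rewrite -(ler_pM2l t0); move: h; rewrite expr2; lra.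
have : t * b <= a.
  by rewrite /t mulrAC ler_pdivrMr // ler_pM2l // lerDr ltW.
lra.
Qed.

Lemma Proj_contract z v : X v ->
  dotp (Proj X z - v) (Proj X z - v) <= dotp (z - v) (z - v).
Proof.
move=> Xv; have := Proj_variational z Xv; set p := Proj X z => h.
have -> : z - v = (p - v) - (-1) *: (z - p).
  by rewrite scaleN1r opprK [RHS]addrC addrA subrK.
rewrite dotp_sub_scale; have := dotp_ge0 (z - p).
have -> : dotp (p - v) (z - p) = - dotp (z - p) (v - p).
  by rewrite dotpC -dotpNr opprB.
lra.
Qed.

(** Adding the variational inequalities of both projections. *)
Lemma Proj_nonexpansive z z' :
  dotp (Proj X z - Proj X z') (Proj X z - Proj X z') <= dotp (z - z') (z - z').
Proof.
have [Xp _] := Proj_spec z; have [Xp' _] := Proj_spec z'.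
have := Proj_variational z Xp'; have := Proj_variational z' Xp.
set p := Proj X z; set p' := Proj X z' => h' h.
have -> : z - z' = (p - p') - (-1) *: ((z - p) - (z' - p')).
  by rewrite scaleN1r opprK; apply/matrixP => i j; rewrite !mxE; ring.
have : 0 <= dotp (p - p') ((z - p) - (z' - p')).
  rewrite dotpBr.
  have -> : dotp (p - p') (z - p) = - dotp (z - p) (p' - p).
    by rewrite dotpC -dotpNr opprB.
  by rewrite (dotpC (p - p')); lra.
move: (_ - _ - _) => e hc; rewrite dotp_sub_scale; have := dotp_ge0 e; lra.
Qed.

Lemma continuous_Proj : continuous (Proj X).
Proof.
move=> z; have fz : Filter (nbhs z) by exact: nbhs_filter.
apply/cvgrPdist_lt => e e0.
near=> u.
rewrite [`|_|]mx_normrE; apply/bigmax_ltP; split => // -[i j] _ /=.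
rewrite (ord1 j).
have : dotp (z - u) (z - u) < e ^+ 2.
  near: u; apply: (@cvgr_lt R _ (nbhs z) (nbhs_filter z) _ _
    (@continuous_dotp_sub R d z z)).
  by rewrite subrr dotpE big1 ?exprn_gt0 // => k _; rewrite mxE mul0r.
move=> /(le_lt_trans (Proj_nonexpansive z u)).
move=> /(le_lt_trans (sqr_entry_le_dotp _ i)).
by rewrite -[X in X < _]real_normK ?num_real // ltr_pXn2r ?nnegrE // ltW.
Unshelve. all: by end_near. Qed.
End projection.

(** * Borel measurability of matrix-valued maps *)

Section borel_matrix.
Context (R : realType).

Lemma measurable_open_matrix (p q : nat) (A : set 'M[R]_(p, q)) :
  open A -> measurable (A : set (borelM R p q)).
Proof. by move=> oA; exact: sub_gen_smallest. Qed.

(** The Borel sigma-algebra is generated by the entries: by separability, an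
    open set of matrices is the union of the countably many boxes with rational
    centre and radius [1 / (N + 1)] that it contains. *)
Lemma measurable_fun_matrix d (T : measurableType d) (p q : nat)
    (u : T -> borelM R p q) :
  (forall i j, measurable_fun setT (fun t => (u t : 'M[R]_(p, q)) i j)) ->
  measurable_fun setT u.
Proof.
move=> mu; apply: (@measurability _ _ T (borelM R p q) setT u
  (@open 'M[R]_(p, q)) erefl).
move=> _ [A oA <-]; rewrite setTI.
pose box (cN : 'M[rat]_(p, q) * nat) : set 'M[R]_(p, q) :=
  ball (map_mx (@ratr R) cN.1) (cN.2.+1%:R^-1).
have -> : u @^-1` A =
    \bigcup_(cN in [set cN | box cN `<=` A]) (u @^-1` box cN).
  rewrite -preimage_bigcup; congr (_ @^-1` _); apply/seteqP; split => [M AM|M].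
    have /nbhs_ballP[e /= e0 eA] : nbhs M A by exact: open_nbhs_nbhs.
    have [N Ne] : exists N, N.+1%:R^-1 < e / 2.
      have e2 : 0 < e / 2 by rewrite divr_gt0.
      have := near_infty_natSinv_lt (PosNum e2).
      by move=> [N _ /(_ N (leqnn N))]; exists N.
    have N0 : 0 < N.+1%:R^-1 :> R by rewrite invr_gt0 ltr0n.
    have ex i j : exists r : rat, `|ratr r - M i j| < N.+1%:R^-1.
      have /rat_in_itvoo[r] : M i j < M i j + N.+1%:R^-1 by rewrite ltrDl.
      rewrite in_itv /= => /andP[r1 r2]; exists r.
      by rewrite gtr0_norm ?subr_gt0 // ltrBlDl.
    pose c : 'M[rat]_(p, q) := \matrix_(i, j) sval (cid (ex i j)).
    have cM i j : `|ratr (c i j) - M i j| < N.+1%:R^-1.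
      by rewrite mxE; case: cid.
    exists (c, N); last first.
      by split => // i j; rewrite mxE; exact: cM.
    move=> M' [_ h]; apply: eA; split => // i j.
    have := h i j; rewrite mxE /ball /=; have := cM i j.
    move: (ratr _) => r; rewrite distrC => h1 h2.
    apply: (le_lt_trans (ler_distD r _ _)); rewrite [e]splitr.
    by apply: ltrD; [exact: lt_trans h1 Ne|exact: lt_trans h2 Ne].
  by move=> [cN bA bM]; exact: bA.
rewrite bigcup_mkcond; apply: countable_bigcupT_measurable => [|cN].
  exact: countableP.
case: ifPn => // _.
have -> : u @^-1` box cN = \bigcap_(i in setT) \bigcap_(j in setT)
    [set t | `|ratr (cN.1 i j) - (u t : 'M[R]_(p, q)) i j| < cN.2.+1%:R^-1].
  apply/seteqP; split => t /=.
    by move=> [_ h] i _ j _ /=; have := h i j; rewrite /ball /= mxE.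
  move=> h; split=> [|i j]; first by rewrite /= invr_gt0 ltr0n.
  by rewrite mxE /ball /=; exact: h.
apply: fin_bigcap_measurable => // i _.
apply: fin_bigcap_measurable => // j _.
rewrite -[X in measurable X]setTI.
have mlt : measurable_fun setT
    (fun t => `|ratr (cN.1 i j) - (u t : 'M[R]_(p, q)) i j| < cN.2.+1%:R^-1).
  apply: measurable_fun_ltr => //; apply: measurableT_comp => //.
  exact: measurable_funB.
exact: (mlt measurableT [set true]).
Qed.

Lemma continuous_measurable_entry (p q : nat) (h : 'M[R]_(p, q) -> R) :
  continuous h -> measurable_fun setT (h : borelM R p q -> R).
Proof.
move=> ch; apply: (measurability _ (RGenOpens.measurableE R)).
move=> _ [_ [a [b ->]] <-]; rewrite setTI.
apply: measurable_open_matrix; apply: open_comp; last exact: interval_open.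
by move=> M _; exact: ch.
Qed.

Lemma measurable_entry (p q : nat) (i : 'I_p) (j : 'I_q) :
  measurable_fun setT (fun A : borelM R p q => (A : 'M[R]_(p, q)) i j).
Proof. by apply: continuous_measurable_entry; exact: coord_continuous. Qed.

Lemma measurable_continuous_matrix (p q r s : nat)
    (h : 'M[R]_(p, q) -> 'M[R]_(r, s)) :
  continuous h -> measurable_fun setT (h : borelM R p q -> borelM R r s).
Proof.
move=> ch; apply: measurable_fun_matrix => i j.
apply: continuous_measurable_entry => M.
exact: (continuous_comp (ch M) (@coord_continuous _ _ _ i j _)).
Qed.

End borel_matrix.

Section measurable_matrix_operations.
Context (R : realType) (d : measure_display) (T : measurableType d).

(** Stated on entries, so that matrix operations reduce to real ones; by
    [measurable_fun_matrix] it is Borel measurability. *)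
Definition mmeasurable (p q : nat) (u : T -> 'M[R]_(p, q)) :=
  forall i j, measurable_fun setT (fun t => u t i j).

Lemma mmeasurable_comp (p q r s : nat) (h : 'M[R]_(p, q) -> 'M[R]_(r, s))
    (u : T -> 'M[R]_(p, q)) :
  continuous h -> mmeasurable u -> mmeasurable (h \o u).
Proof.
move=> ch mu i j.
apply: (measurableT_comp (measurable_entry i j)).
apply: (measurableT_comp (measurable_continuous_matrix ch)).
exact: measurable_fun_matrix.
Qed.

Lemma mmeasurable_cst (p q : nat) (A : 'M[R]_(p, q)) :
  mmeasurable (fun _ : T => A).
Proof. by move=> i j; exact: measurable_cst. Qed.

Lemma mmeasurable_tr (p q : nat) (u : T -> 'M[R]_(p, q)) :
  mmeasurable u -> mmeasurable (fun t => (u t)^T).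
Proof. by move=> mu i j; under eq_fun do rewrite mxE; exact: mu. Qed.

Lemma mmeasurableB (p q : nat) (u v : T -> 'M[R]_(p, q)) :
  mmeasurable u -> mmeasurable v -> mmeasurable (fun t => u t - v t).
Proof.
move=> mu mv i j; under eq_fun do rewrite !mxE.
by apply: measurable_funB; [exact: mu|exact: mv].
Qed.

Lemma mmeasurableZ (p q : nat) (a : R) (u : T -> 'M[R]_(p, q)) :
  mmeasurable u -> mmeasurable (fun t => a *: u t).
Proof.
move=> mu i j; under eq_fun do rewrite mxE.
by apply: measurable_funM => //; exact: mu.
Qed.

Lemma mmeasurableM (p q r : nat) (u : T -> 'M[R]_(p, q))
    (v : T -> 'M[R]_(q, r)) :
  mmeasurable u -> mmeasurable v -> mmeasurable (fun t => u t *m v t).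
Proof.
move=> mu mv i j; under eq_fun do rewrite mxE.
apply: measurable_sum => k.
by apply: measurable_funM; [exact: mu|exact: mv].
Qed.

Lemma measurable_dotp (p : nat) (u v : T -> 'cV[R]_p) :
  mmeasurable u -> mmeasurable v ->
  measurable_fun setT (fun t => dotp (u t) (v t)).
Proof.
by move=> mu mv; exact: (mmeasurableM (mmeasurable_tr mu) mv).
Qed.

End measurable_matrix_operations.

(** * Conditional expectations given the regressor *)

Section take_out.
Context (R : realType) (d d' : measure_display) (T : measurableType d)
  (T' : measurableType d') (mu : {measure set T -> \bar R}) (eta : T -> T').
Hypothesis meta : measurable_fun setT eta.

Let measurable_eta (B : set T') : measurable B -> measurable (eta @^-1` B).
Proof. by move=> mB; rewrite -[_ @^-1` _]setTI; exact: meta. Qed.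

Variables (C : set T') (D : T -> R).
Hypothesis mC : measurable C.
Hypothesis iD : mu.-integrable (eta @^-1` C) (EFin \o D).
Hypothesis D0 : forall B : set T', measurable B -> B `<=` C ->
  (\int[mu]_(w in eta @^-1` B) (D w)%:E = 0)%E.

Import HBNNSimple.

Let integrable_mul_bounded (g : T' -> R) (K : R) :
  measurable_fun setT g -> (forall t, C t -> `|g t| <= K) ->
  mu.-integrable (eta @^-1` C) (fun w => (g (eta w) * D w)%:E).
Proof.
move=> mg gK; apply: (integrableMr (measurable_eta mC) (h := g \o eta) _ _ iD).
  by apply: measurable_funTS; exact: measurableT_comp.
exists K; split; first exact: num_real.
by move=> M KM w Cw /=; rewrite (le_trans (gK _ Cw)) // ltW.
Qed.

(** The level sets of [h] cut [C] into finitely many events, on each of which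
    the integral of [D] vanishes. *)
Lemma integral_nnsfun_mul_eq0 (h : {nnsfun T' >-> R}) :
  (\int[mu]_(w in eta @^-1` C) (h (eta w) * D w)%:E = 0)%E.
Proof.
have mE := measurable_eta mC.
set s := finmap.enum_fset (fset_set (range h)).
pose B (i : 'I_(size s)) := h @^-1` [set s`_i].
have mB i : measurable (B i) by exact: measurable_funPTI.
have iI i : mu.-integrable (eta @^-1` C)
    (fun w => (\1_(B i) (eta w) * D w)%:E).
  apply: (integrable_mul_bounded (K := 1)); first exact: measurable_indic.
  by move=> t _; rewrite indicE ger0_norm ?ler0n // lern1 leq_b1.
under eq_integral do rewrite fimfunEord mulr_suml -sumEFin.
rewrite integral_sum //; last first.
  move=> i; under eq_fun do rewrite -mulrA EFinM.
  exact: (integrableZl mE _ (iI i)).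
apply: big1 => i _; under eq_integral do rewrite -mulrA EFinM.
rewrite (integralZl mE (iI i)).
suff -> : (\int[mu]_(w in eta @^-1` C) (\1_(B i) (eta w) * D w)%:E = 0)%E.
  by rewrite mule0.
rewrite -[RHS](D0 (measurableI _ _ mC (mB i))); last by move=> t [].
rewrite preimage_setI integral_mkcondr; apply: eq_integral => w _.
rewrite patchE indicE; have -> : (w \in eta @^-1` B i) = (eta w \in B i).
  by apply/idP/idP => /set_mem /mem_set.
by case: ifPn; rewrite ?mul1r ?mul0r.
Qed.

(** Taking out what is known: a bounded function of [eta] is a pointwise limit
    of simple functions of [eta], and dominated convergence applies. *)
Lemma integral_bounded_mul_eq0 (g : T' -> R) (K : R) :
  measurable_fun setT g -> (forall t, C t -> `|g t| <= K) ->
  mu.-integrable (eta @^-1` C) (fun w => (g (eta w) * D w)%:E) /\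
  (\int[mu]_(w in eta @^-1` C) (g (eta w) * D w)%:E = 0)%E.
Proof.
move=> mg gK; have ig := integrable_mul_bounded mg gK; split => //.
have mE := measurable_eta mC.
(* Shifted by [K], [g] is nonnegative on [C], hence a nondecreasing limit of
   nonnegative simple functions. *)
have mgK : measurable_fun C (fun t => (g t + K)%:E).
  by apply/measurable_EFinP/measurable_funTS; exact: measurable_funD.
have gK0 t : C t -> (0 <= (g t + K)%:E)%E.
  by move=> /gK; rewrite ler_norml lee_fin => /andP[+ _]; lra.
pose h := nnsfun_approx mC mgK.
have hg t : C t -> h ^~ t @ \oo --> g t + K.
  move=> Ct; have := cvg_nnsfun_approx mC mgK gK0 Ct.
  by move=> /fine_cvgP[_]; exact.
have hK n t : C t -> `|h n t| <= 2 * K.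
  move=> Ct; rewrite ger0_norm; last exact: fun_ge0.
  have nd : nondecreasing_seq (h ^~ t).
    by move=> a b ab; have /lefP := nd_nnsfun_approx mC mgK ab; exact.
  have := nondecreasing_cvgn_le nd (cvgP _ (hg t Ct)) n.
  rewrite (cvg_lim _ (hg t Ct)) // => /le_trans; apply.
  by have := gK t Ct; rewrite ler_norml => /andP[_]; lra.
have mhD n : measurable_fun (eta @^-1` C) (fun w => (h n (eta w) * D w)%:E).
  have h1 := @integrable_mul_bounded (h n) (2 * K) _ (hK n).
  by apply: (measurable_int mu); apply: h1; exact: measurable_funPT.
have mlim : measurable_fun (eta @^-1` C) (fun w => ((g (eta w) + K) * D w)%:E).
  apply: (measurable_int mu).
  apply: (@integrable_mul_bounded (fun t => g t + K) (2 * K)).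
    exact: measurable_funD.
  move=> t /gK h1; rewrite (le_trans (ler_normD _ _)) //.
  have : `|K| = K by apply/ger0_norm/(le_trans _ h1).
  by move=> ->; lra.
(* [h n] lies between [0] and [2 K], whence the dominating function. *)
have icD : mu.-integrable (eta @^-1` C) (fun w => ((2 * K) * `|D w|)%:E).
  under eq_fun do rewrite EFinM; apply: integrableZl => //.
  exact: integrable_norm.
have [||_ _] := dominated_convergence mE mhD mlim _ icD.
- apply: aeW => w Cw; apply: cvg_EFin; first exact: nearW.
  exact: (cvgM (hg _ Cw) (cvg_cst _)).
- apply: aeW => w n Cw; rewrite abse_EFin normrM lee_fin.
  by apply: ler_wpM2r => //; exact: hK.
rewrite (_ : [sequence _]_n = cst 0%E); last first.
  by apply/funext => n; exact: integral_nnsfun_mul_eq0.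
move=> /(cvg_unique _ (cvg_cst 0%E)) /esym E.
move: E; under eq_integral do rewrite mulrDl EFinD [(K * _)%:E]EFinM.
rewrite integralD //; last exact: integrableZl.
rewrite integralZl // D0 // mule0 adde0.
by apply; exact: ereal_hausdorff.
Qed.

End take_out.

Section conditional_expectation.
Context (R : realType) (d d' : measure_display) (T : measurableType d)
  (T' : measurableType d') (P : probability T R) (eta : T -> T').
Hypothesis meta : measurable_fun setT eta.

Let measurable_eta (B : set T') : measurable B -> measurable (eta @^-1` B).
Proof. by move=> mB; rewrite -[_ @^-1` _]setTI; exact: meta. Qed.

Lemma cond_expectation_centered (Y : T -> R) (phi : T' -> R) (C : set T')
    (N : R) :
  cond_expectation P eta Y phi -> measurable C ->
  P.-integrable (eta @^-1` C) (EFin \o Y) ->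
  (forall t, C t -> `|phi t| <= N) ->
  P.-integrable (eta @^-1` C) (fun w => (Y w - phi (eta w))%:E) /\
  forall B : set T', measurable B -> B `<=` C ->
    (\int[P]_(w in eta @^-1` B) (Y w - phi (eta w))%:E = 0)%E.
Proof.
move=> [mphi _ E] mC iY phiN.
have iphi : P.-integrable (eta @^-1` C) (EFin \o (phi \o eta)).
  apply: measurable_bounded_integrable => //; first exact: measurable_eta.
  - rewrite (le_lt_trans (probability_le1 _ _)) ?ltry //.
    exact: measurable_eta.
  - by apply: measurable_funTS; exact: measurableT_comp.
  - exists N; split; first exact: num_real.
    by move=> M NM w Cw /=; rewrite (le_trans (phiN _ Cw)) // ltW.
split=> [|B mB BC].
  under eq_fun do rewrite EFinB.
  by apply: integrableB => //; exact: measurable_eta.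
have [mEC mEB] := (measurable_eta mC, measurable_eta mB).
have sE : eta @^-1` B `<=` eta @^-1` C by move=> w /BC.
have iYB : P.-integrable (eta @^-1` B) (EFin \o Y) by exact: integrableS iY.
have ipB : P.-integrable (eta @^-1` B) (EFin \o (phi \o eta)).
  exact: integrableS iphi.
under eq_integral do rewrite EFinB.
rewrite integralB // E // subee //.
exact: (integrable_fin_num mEB ipB).
Qed.

Context (m : nat) (Y : 'I_m -> T -> R) (phi g : 'I_m -> T' -> R).
Hypothesis hY : forall j, cond_expectation P eta (Y j) (phi j).
Hypothesis mg : forall j, measurable_fun setT (g j).

Let Z w := \sum_(j < m) g j (eta w) * (Y j w - phi j (eta w)).

(** A piece is a set on which every [Y j] is integrable and every [g j] and
    [phi j] is bounded; finitely many covers are refined by a single one,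
    indexed by a choice of one piece in each cover and a bound. *)
Lemma cover_integral_centered_eq0 : exists C : (set T')^nat,
  [/\ forall k, measurable (C k), trivIset setT C, \bigcup_k C k = setT &
      forall k, P.-integrable (eta @^-1` C k) (EFin \o Z) /\
                (\int[P]_(w in eta @^-1` C k) (Z w)%:E = 0)%E].
Proof.
have /choice[B hB] : forall j, exists B : (set T')^nat,
    [/\ forall i, measurable (B i), \bigcup_i B i = setT &
        forall i, P.-integrable (eta @^-1` B i) (EFin \o Y j)].
  by move=> j; have [] := hY j.
pose A (i : {ffun 'I_m -> nat} * nat) := \bigcap_(j in [set: 'I_m])
  (B j (i.1 j) `&` [set t | `|g j t| <= i.2%:R] `&`
   [set t | `|phi j t| <= i.2%:R]).
have mle (h : T' -> R) (r : R) : measurable_fun setT h ->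
    measurable [set t | `|h t| <= r].
  move=> mh; rewrite -[X in measurable X]setTI.
  have ml : measurable_fun setT (fun t => `|h t| <= r).
    by apply: measurable_fun_ler => //; exact: measurableT_comp.
  exact: (ml measurableT [set true]).
have mA i : measurable (A i).
  apply: fin_bigcap_measurable => // j _.
  apply: measurableI; last by apply: mle; case: (hY j).
  by apply: measurableI; [case: (hB j)|exact: mle].
have Acover t : exists i, A i t.
  have /choice[s hs] : forall j, exists k, B j k t.
    move=> j; have [_ Bc _] := hB j.
    have : (\bigcup_i B j i) t by rewrite Bc.
    by move=> [k _]; exists k.
  pose K := \sum_(j < m) (`|g j t| + `|phi j t|).
  exists ([ffun j => s j], Num.bound K) => j _ /=; rewrite ffunE.
  have gphi : `|g j t| + `|phi j t| <= (Num.bound K)%:R.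
    rewrite (le_trans _ (ltW (archi_boundP _))) //; last first.
      by apply: sumr_ge0 => k _; exact: addr_ge0.
    by rewrite /K (bigD1 j) //= lerDl; apply: sumr_ge0 => k _; exact: addr_ge0.
  split; [split; first exact: hs|]; rewrite /= (le_trans _ gphi) //.
  + by rewrite lerDl.
  + by rewrite lerDr.
pose A0 k := if unpickle k is Some i then A i else set0.
have mA0 k : measurable (A0 k) by rewrite /A0; case: unpickle.
have mC k : measurable (seqDU A0 k).
  by apply: measurableD => //; exact: bigsetU_measurable.
exists (seqDU A0); split; [exact: mC|exact: trivIset_seqDU| |].
- rewrite -seqDU_bigcup_eq; apply/seteqP; split => // t _.
  by have [i Ai] := Acover t; exists (pickle i) => //; rewrite /A0 pickleK.
move=> k; have mE := measurable_eta (mC k).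
have [i CA] : exists i, seqDU A0 k `<=` A i.
  have := @subset_seqDU _ A0 k; rewrite /A0; case: unpickle => [i|] h.
    by exists i.
  by exists ([ffun=> 0%N], 0%N) => t /h.
have h j : P.-integrable (eta @^-1` seqDU A0 k)
      (fun w => (g j (eta w) * (Y j w - phi j (eta w)))%:E) /\
    (\int[P]_(w in eta @^-1` seqDU A0 k)
      (g j (eta w) * (Y j w - phi j (eta w)))%:E = 0)%E.
  have [mBj _ iBj] := hB j.
  have iY : P.-integrable (eta @^-1` seqDU A0 k) (EFin \o Y j).
    apply: (integrableS (measurable_eta (mBj (i.1 j)))) => //.
    by move=> w /CA /(_ j I) [[]].
  have [iD D0] := cond_expectation_centered (N := i.2%:R) (hY j) (mC k) iY
    (fun t Ct => (CA t Ct j I).2).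
  exact: (integral_bounded_mul_eq0 meta (mC k) iD D0 (mg j)
    (fun t Ct => (CA t Ct j I).1.2)).
rewrite /Z; split.
  apply: (eq_integrable mE (fun w => \sum_(j < m)
      (g j (eta w) * (Y j w - phi j (eta w)))%:E)) => [w _|].
    by rewrite sumEFin.
  by apply: integrable_sum => // j _; have [] := h j.
under eq_integral do rewrite -sumEFin.
rewrite integral_sum // => [|j]; last by have [] := h j.
by apply: big1 => j _; have [] := h j.
Qed.

Lemma integral_centered_eq0 :
  P.-integrable setT (EFin \o Z) -> (\int[P]_w (Z w)%:E = 0)%E.
Proof.
have [C [mC tC UC h]] := cover_integral_centered_eq0 => iZ.
have UE : \bigcup_k (eta @^-1` C k) = setT by rewrite -preimage_bigcup UC.
have tE : trivIset setT (fun k => eta @^-1` C k).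
  by move=> i j _ _ [w [Ci Cj]]; apply: tC => //; exists (eta w).
rewrite -UE integral_bigcup.
- by rewrite eseries0 // => k _ _; have [] := h k.
- exact: tE.
- by move=> k; exact: measurable_eta.
- by rewrite UE.
Qed.

(** The form in which Jensen's inequality for conditional expectations is used:
    if [u = E (v | eta)], then in [|u|^2 + 2 u.(v - u) <= |v|^2] the cross term
    is a combination of centered variables with coefficients that are functions
    of [eta].  This cross term need not be integrable, hence the summation over
    the pieces of the cover. *)
Lemma integral_le_centered (U V : T -> R) :
  measurable_fun setT U -> P.-integrable setT (EFin \o V) ->
  (forall w, 0 <= U w) -> (forall w, 0 <= V w) ->
  (forall w, U w + Z w <= V w) ->
  (\int[P]_w (U w)%:E <= \int[P]_w (V w)%:E)%E.
Proof.
have [C [mC tC UC h]] := cover_integral_centered_eq0 => mU iV U0 V0 UZV.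
have UE : \bigcup_k (eta @^-1` C k) = setT by rewrite -preimage_bigcup UC.
have mE k := measurable_eta (mC k).
have tE : trivIset setT (fun k => eta @^-1` C k).
  by move=> i j _ _ [w [Ci Cj]]; apply: tC => //; exists (eta w).
rewrite -UE !ge0_integral_bigcup //; last 4 first.
- by rewrite UE; exact: measurable_int iV.
- by move=> w _; rewrite lee_fin.
- by rewrite UE; exact/measurable_EFinP.
- by move=> w _; rewrite lee_fin.
apply: lee_nneseries => [k _ _|k _].
  by apply: integral_ge0 => w _; rewrite lee_fin.
have [iZ Z0] := h k.
have iVk : P.-integrable (eta @^-1` C k) (EFin \o V) by exact: integrableS iV.
rewrite -[leRHS]sube0 -Z0 -integralB //.
apply: ge0_le_integral => //.
- by move=> w _; rewrite lee_fin.
- exact/measurable_EFinP/measurable_funTS.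
- by apply: (measurable_int P); exact: integrableB.
- by move=> w _; rewrite -EFinB lee_fin lerBrDr.
Qed.

End conditional_expectation.

(** * The regression field and one step of the recurrence *)

Section mean.
Context (R : realType) (d : measure_display) (T : measurableType d)
  (mu : probability T R).
Implicit Types (h : T -> R) (r c : R).

(** Integrability and the value of the integral in one statement, so that
    linear combinations of integrals are computed in [R]. *)
Definition has_mean h r :=
  mu.-integrable setT (EFin \o h) /\ \int[mu]_w h w = r.

Lemma has_mean_integral h r : has_mean h r -> (\int[mu]_w (h w)%:E = r%:E)%E.
Proof.
by move=> [ih <-]; rewrite /Rintegral fineK //; exact: integrable_fin_num ih.
Qed.

Lemma integral_has_mean h r : mu.-integrable setT (EFin \o h) ->
  (\int[mu]_w (h w)%:E = r%:E)%E -> has_mean h r.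
Proof. by move=> ih E; split; rewrite // /Rintegral E. Qed.

Lemma ge0_integral_has_mean h c : measurable_fun setT h ->
  (forall w, 0 <= h w) -> (\int[mu]_w (h w)%:E <= c%:E)%E ->
  exists2 r, has_mean h r & r <= c.
Proof.
move=> mh h0 hc.
have ih : mu.-integrable setT (EFin \o h).
  apply/integrableP; split; first exact/measurable_EFinP.
  under eq_integral do rewrite /= ger0_norm //.
  by rewrite (le_lt_trans hc) ?ltry.
exists (\int[mu]_w h w) => //.
by rewrite -lee_fin -(has_mean_integral (conj ih erefl)).
Qed.

Lemma has_mean_cst c : has_mean (fun=> c) c.
Proof.
split; first exact: finite_measure_integrable_cst.
rewrite Rintegral_cst // -[RHS]mulr1; congr (c * _).
exact: (congr1 fine (probability_setT mu)).
Qed.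

Lemma has_meanD h h' r r' : has_mean h r -> has_mean h' r' ->
  has_mean (fun w => h w + h' w) (r + r').
Proof.
move=> [ih <-] [ih' <-]; split; last by rewrite RintegralD.
exact: (integrableD measurableT ih ih').
Qed.

Lemma has_meanZ c h r : has_mean h r -> has_mean (fun w => c * h w) (c * r).
Proof.
move=> [ih <-]; split; last by rewrite RintegralZl.
exact: (integrableZl measurableT c ih).
Qed.

Lemma has_meanB h h' r r' : has_mean h r -> has_mean h' r' ->
  has_mean (fun w => h w - h' w) (r - r').
Proof.
move=> hr hr'; have := has_meanD hr (has_meanZ (-1) hr').
by rewrite mulN1r; under eq_fun do rewrite mulN1r.
Qed.

Lemma has_mean_le h h' r r' : has_mean h r -> has_mean h' r' ->
  (forall w, h w <= h' w) -> r <= r'.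
Proof. by move=> [ih <-] [ih' <-] hh'; apply: le_Rintegral. Qed.

Lemma integrable_dotp (p : nat) (u : T -> 'cV[R]_p) (v : 'cV[R]_p) (r : R) :
  mmeasurable u -> has_mean (fun t => dotp (u t) (u t)) r ->
  mu.-integrable setT (fun t => (dotp v (u t))%:E).
Proof.
move=> mu_ hu; have [iuv _] := has_meanD hu (has_mean_cst (dotp v v)).
apply: (le_integrable _ _ _ iuv) => //.
  by apply/measurable_EFinP; exact: measurable_dotp.
move=> t _; rewrite /= lee_fin addrC (le_trans (normr_dotp_le _ _)) //.
exact: ler_norm.
Qed.

End mean.

Section model.
Context (R : realType) (m n : nat) (X : set 'cV[R]_n)
  (f : 'cV[R]_m -> 'cV[R]_m) (P : 'cV[R]_n -> probability (obs R n m) R)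
  (Q : probability (borelM R n m) R) (kappa M : R).
Hypothesis hQ : forall x, X x -> forall B : set (borelM R n m), measurable B ->
  P x (fst @^-1` B) = Q B.
Hypothesis hy : forall x, X x -> forall i : 'I_m,
  cond_expectation (P x) fst (fun w : obs R n m => (w.2 : 'cV[R]_m) i ord0)
    (fun eta : borelM R n m => f ((eta : 'M[R]_(n, m))^T *m x) i ord0).
Hypothesis hfc : continuous f.
Hypothesis hF : forall (z : 'cV[R]_n) (i : 'I_n),
  Q.-integrable setT (fun eta : borelM R n m =>
    (((eta : 'M[R]_(n, m)) *m f ((eta : 'M[R]_(n, m))^T *m z)) i ord0)%:E).
Hypothesis hM : forall x, X x ->
  (\int[P x]_w (norm2 ((w.1 : 'M[R]_(n, m)) *m (w.2 : 'cV[R]_m)) ^+ 2)%:E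
    <= (M ^+ 2)%:E)%E.

Definition field_at (z : 'cV[R]_n) (eta : borelM R n m) : 'cV[R]_n :=
  (eta : 'M[R]_(n, m)) *m f ((eta : 'M[R]_(n, m))^T *m z).

Definition scaled_label (w : obs R n m) : 'cV[R]_n :=
  (w.1 : 'M[R]_(n, m)) *m (w.2 : 'cV[R]_m).

Lemma mmeasurable_fst : mmeasurable (fun w : obs R n m => (w.1 : 'M[R]_(n, m))).
Proof.
by move=> i j; exact: measurableT_comp (measurable_entry i j) measurable_fst.
Qed.

Lemma mmeasurable_snd : mmeasurable (fun w : obs R n m => (w.2 : 'cV[R]_m)).
Proof.
by move=> i j; exact: measurableT_comp (measurable_entry i j) measurable_snd.
Qed.

Lemma mmeasurable_field (d : measure_display) (T : measurableType d)
    (eta : T -> 'M[R]_(n, m)) (z : T -> 'cV[R]_n) :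
  mmeasurable eta -> mmeasurable z ->
  mmeasurable (fun t => eta t *m f ((eta t)^T *m z t)).
Proof.
move=> meta mz; apply: mmeasurableM => //.
apply: (mmeasurable_comp hfc); apply: mmeasurableM => //.
exact: mmeasurable_tr.
Qed.

Lemma mmeasurable_field_at z : mmeasurable (field_at z).
Proof.
apply: mmeasurable_field; first exact: measurable_entry.
exact: mmeasurable_cst.
Qed.

Lemma mmeasurable_field_fst z :
  mmeasurable (fun w : obs R n m => field_at z w.1).
Proof.
apply: mmeasurable_field; first exact: mmeasurable_fst.
exact: mmeasurable_cst.
Qed.

Lemma mmeasurable_scaled_label : mmeasurable scaled_label.
Proof. exact: mmeasurableM mmeasurable_fst mmeasurable_snd. Qed.

Lemma ge0_integral_marginal x (h : borelM R n m -> R) : X x ->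
  measurable_fun setT h -> (forall eta, 0 <= h eta) ->
  (\int[P x]_w (h w.1)%:E = \int[Q]_eta (h eta)%:E)%E.
Proof.
move=> Xx mh h0.
have := @ge0_integral_pushforward _ _ _ _ R _ measurable_fst (P x) setT
  (EFin \o h) measurableT.
rewrite preimage_setT => <- //; last 2 first.
- exact/measurable_EFinP.
- by move=> eta _; rewrite lee_fin.
by apply: eq_measure_integral => B mB _; exact: hQ.
Qed.

Lemma has_mean_marginal x (h : borelM R n m -> R) (r : R) : X x ->
  has_mean Q h r -> has_mean (P x) (fun w => h w.1) r.
Proof.
move=> Xx hr; have [/integrableP[/measurable_EFinP mh fh] _] := hr.
have ihx : (P x).-integrable setT (EFin \o (fun w : obs R n m => h w.1)).
  apply/integrableP; split.
    by apply/measurable_EFinP; exact: measurableT_comp mh measurable_fst.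
  rewrite (ge0_integral_marginal (h := fun eta => `|h eta|) Xx) //.
  exact: measurableT_comp.
apply: integral_has_mean => //; rewrite -(has_mean_integral hr).
have := @integral_pushforward _ _ _ _ R _ measurable_fst (P x) setT
  (EFin \o h) (measurable_int Q hr.1).
rewrite preimage_setT => /(_ ihx measurableT) <-.
by apply: eq_measure_integral => B mB _; exact: hQ.
Qed.

Lemma scaled_label_second_moment x : X x ->
  exists2 r, has_mean (P x) (fun w => dotp (scaled_label w) (scaled_label w)) r
           & r <= M ^+ 2.
Proof.
move=> Xx; apply: ge0_integral_has_mean => [|w|]; last 2 first.
- exact: dotp_ge0.
- by under eq_integral do rewrite -sqr_norm2; exact: hM.
exact: measurable_dotp mmeasurable_scaled_label mmeasurable_scaled_label.
Qed.

Lemma field_label_centeredE z (w : obs R n m) (u : 'cV[R]_n) :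
  \sum_(j < m) ((w.1 : 'M[R]_(n, m))^T *m u) j ord0 *
     ((w.2 : 'cV[R]_m) j ord0 - f ((w.1 : 'M[R]_(n, m))^T *m z) j ord0)
  = dotp u (scaled_label w - field_at z w.1).
Proof.
rewrite /scaled_label /field_at -mulmxBr dotp_mulmxr dotpE.
by apply: eq_bigr => j _; rewrite !mxE.
Qed.

(** Under [P_z] the field at [z] is the conditional expectation of the scaled
    label, hence has the smaller second moment; and its distribution depends on
    the regressor only, so the bound also holds under every other signal. *)
Lemma field_second_moment z : X z ->
  exists2 r, has_mean Q (fun eta => dotp (field_at z eta) (field_at z eta)) r
           & r <= M ^+ 2.
Proof.
move=> Xz.
have mU := measurable_dotp (mmeasurable_field_at z) (mmeasurable_field_at z).
apply: ge0_integral_has_mean => // [eta|]; first exact: dotp_ge0.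
rewrite -(ge0_integral_marginal Xz mU); last by move=> eta; exact: dotp_ge0.
have [r [iV _] _] := scaled_label_second_moment Xz.
apply: le_trans (hM Xz); under [leRHS]eq_integral do rewrite sqr_norm2.
pose g (j : 'I_m) (eta : borelM R n m) : R :=
  ((eta : 'M[R]_(n, m))^T *m (2 *: field_at z eta)) j ord0.
have mg j : measurable_fun setT (g j).
  apply: mmeasurableM; first by apply: mmeasurable_tr; exact: measurable_entry.
  by apply: mmeasurableZ; exact: mmeasurable_field_at.
apply: (integral_le_centered measurable_fst (hy Xz) mg) => //.
- exact: measurable_dotp (mmeasurable_field_fst z) (mmeasurable_field_fst z).
- by move=> w; exact: dotp_ge0.
- by move=> w; exact: dotp_ge0.
- by move=> w; rewrite /g field_label_centeredE dotpZl; exact: dotp_sub_ge.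
Qed.

Lemma has_mean_field z (v : 'cV[R]_n) : X z ->
  has_mean Q (fun eta => dotp v (field_at z eta))
    (dotp v (regression_field Q f z)).
Proof.
move=> Xz; have [r hr _] := field_second_moment Xz.
apply: integral_has_mean.
  exact: integrable_dotp (mmeasurable_field_at z) hr.
under eq_integral do rewrite dotpE -sumEFin.
rewrite integral_sum // => [|i].
  rewrite dotpE -sumEFin; apply: eq_bigr => i _; rewrite mxE.
  under eq_integral do rewrite EFinM.
  rewrite (integralZl _ (hF z i)) // EFinM.
  by rewrite (has_mean_integral (conj (hF z i) erefl)).
under eq_fun do rewrite EFinM.
exact: integrableZl (hF z i).
Qed.

(** Both terms are square integrable, so the residual is integrable on the
    whole space and its zero integrals over the pieces of a cover add up. *)
Lemma has_mean_residual x (v : 'cV[R]_n) : X x ->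
  has_mean (P x) (fun w => dotp v (scaled_label w - field_at x w.1)) 0.
Proof.
move=> Xx; have [r hr _] := scaled_label_second_moment Xx.
have iV := integrable_dotp v mmeasurable_scaled_label hr.
have [iU _] := has_mean_marginal Xx (has_mean_field v Xx).
have iZ : (P x).-integrable setT
    (fun w => (dotp v (scaled_label w - field_at x w.1))%:E).
  by under eq_fun do rewrite dotpBr EFinB; exact: integrableB.
apply: integral_has_mean => //.
pose g (j : 'I_m) (eta : borelM R n m) : R :=
  ((eta : 'M[R]_(n, m))^T *m v) j ord0.
have mg j : measurable_fun setT (g j).
  apply: mmeasurableM; first by apply: mmeasurable_tr; exact: measurable_entry.
  exact: mmeasurable_cst.
under eq_integral do rewrite -field_label_centeredE.
apply: (integral_centered_eq0 measurable_fst (hy Xx) mg).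
by apply: eq_integrable iZ => // w _ /=; rewrite -field_label_centeredE.
Qed.

Hypothesis hkappa : 0 < kappa.
Hypothesis hFkappa : monotone_modulus kappa X (regression_field Q f).

(** Strong monotonicity bounds the diameter of [X]: integrate
    [2 kappa (a - b).v <= |a - b|^2 + kappa^2 |v|^2] over the values [a], [b] of
    the field at [z] and [x], with [v = z - x]; the left-hand side becomes at
    least [2 kappa^2 |v|^2] and the first term on the right at most [4 M^2]. *)
Lemma dotp_diameter z x : X z -> X x ->
  dotp (z - x) (z - x) <= 4 * M ^+ 2 / kappa ^+ 2.
Proof.
move=> Xz Xx; have := hFkappa Xz Xx.
rewrite sqr_norm2 [leRHS]dotpC [leRHS]dotpBr.
set v := z - x; set D := dotp v v => hk.
have [rz hz rzM] := field_second_moment Xz.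
have [rx hx rxM] := field_second_moment Xx.
have hA := has_meanZ (2 * kappa)
  (has_meanB (has_mean_field v Xz) (has_mean_field v Xx)).
have hB := has_meanD (has_meanZ 2 (has_meanD hz hx))
  (has_mean_cst Q (kappa ^+ 2 * D)).
have /(has_mean_le hA hB) : forall eta,
    2 * kappa * (dotp v (field_at z eta) - dotp v (field_at x eta)) <=
    2 * (dotp (field_at z eta) (field_at z eta) +
         dotp (field_at x eta) (field_at x eta)) + kappa ^+ 2 * D.
  move=> eta; have := dotp_sub_le (field_at z eta) (field_at x eta).
  have := dotp_ge0 ((field_at z eta - field_at x eta) - kappa *: v).
  by rewrite dotp_sub_scale (dotpC _ v) -/D -dotpBr; lra.
move=> h; rewrite ler_pdivlMr ?exprn_gt0 //.
move: hk; rewrite -(ler_pM2l hkappa) => hk.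
by move: h hk rzM rxM; rewrite !expr2; lra.
Qed.

Hypothesis X0 : X !=set0.
Hypothesis Xconv : convex_set (X : set (convex_lmodType 'cV[R]_n)).
Hypothesis Xcomp : compact X.

Definition SA_step (gamma : R) (z : 'cV[R]_n) (w : obs R n m) : 'cV[R]_n :=
  Proj X (z - gamma *: (field_at z w.1 - scaled_label w)).

(** With [v = z - x] and [G = U z - V], expand [|v - gamma G|^2]: the cross term
    has mean [v.(F z - F x) >= kappa |v|^2], since [V - U x] is centered, and
    [E |G|^2 <= 2 (E |U z|^2 + E |V|^2) <= 4 M^2]. *)
Lemma integral_SA_step_le gamma z x : 0 <= gamma -> X z -> X x ->
  (\int[P x]_w (dotp (SA_step gamma z w - x) (SA_step gamma z w - x))%:E <=
   ((1 - 2 * kappa * gamma) * dotp (z - x) (z - x) +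
    4 * gamma ^+ 2 * M ^+ 2)%:E)%E.
Proof.
move=> gamma0 Xz Xx; have := hFkappa Xz Xx.
rewrite sqr_norm2 [leRHS]dotpC [leRHS]dotpBr.
set v := z - x; set D := dotp v v => hk.
have [rz hz rzM] := field_second_moment Xz.
have [rV hV rVM] := scaled_label_second_moment Xx.
have h1 := has_meanB (has_mean_marginal Xx
  (has_meanB (has_mean_field v Xz) (has_mean_field v Xx)))
  (has_mean_residual v Xx).
have h2 := has_meanD (has_mean_marginal Xx hz) hV.
have hB := has_meanD (has_meanB (has_mean_cst (P x) D)
  (has_meanZ (2 * gamma) h1)) (has_meanZ (2 * gamma ^+ 2) h2).
apply: (@le_trans _ _ (D - 2 * gamma * (dotp v (regression_field Q f z) -
   dotp v (regression_field Q f x) - 0) + 2 * gamma ^+ 2 * (rz + rV))%:E);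
  last first.
  rewrite lee_fin subr0 mulrBl mul1r.
  have g2 : 0 <= gamma ^+ 2 by exact: sqr_ge0.
  move: hk => /(ler_wpM2l gamma0) hk.
  have := ler_wpM2l g2 (lerD rzM rVM).
  lra.
rewrite -(has_mean_integral hB).
apply: ge0_le_integral => //.
- by move=> w _; rewrite lee_fin dotp_ge0.
- have mstep : mmeasurable (fun w => SA_step gamma z w - x).
    apply: mmeasurableB; last exact: mmeasurable_cst.
    apply: (mmeasurable_comp (continuous_Proj X0 Xconv Xcomp)).
    apply: mmeasurableB; first exact: mmeasurable_cst.
    apply: mmeasurableZ; apply: mmeasurableB.
      exact: mmeasurable_field_fst.
    exact: mmeasurable_scaled_label.
  exact/measurable_EFinP/measurable_dotp.
- exact: measurable_int hB.1.
move=> w _; rewrite lee_fin /SA_step.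
apply: le_trans (Proj_contract X0 Xconv Xcomp _ Xx) _.
set G := field_at z w.1 - scaled_label w.
have -> : z - gamma *: G - x = v - gamma *: G by rewrite addrAC.
have -> : dotp v (field_at z w.1) - dotp v (field_at x w.1) -
    dotp v (scaled_label w - field_at x w.1) = dotp v G.
  by rewrite /G !dotpBr; ring.
rewrite dotp_sub_scale -/D.
have := ler_wpM2l (sqr_ge0 gamma)
  (dotp_sub_le (field_at z w.1) (scaled_label w)).
rewrite -/G; lra.
Qed.

End model.

(** * The iterates as functions of the observations *)

Section SA_iterates.
Context (R : realType) (m n : nat) (X : set 'cV[R]_n)
  (f : 'cV[R]_m -> 'cV[R]_m) (kappa : R) (z0 : 'cV[R]_n).
Hypothesis hfc : continuous f.
Hypothesis X0 : X !=set0.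
Hypothesis Xconv : convex_set (X : set (convex_lmodType 'cV[R]_n)).
Hypothesis Xcomp : compact X.
Hypothesis Xz0 : X z0.

Lemma SA_iter_in w k : X (SA_iter X f kappa z0 w k).
Proof. by case: k => //= k; exact: (Proj_spec X0 Xcomp _).1. Qed.

Lemma eq_SA_iter (w w' : nat -> obs R n m) k :
  (forall i, (i < k)%N -> w i = w' i) ->
  SA_iter X f kappa z0 w k = SA_iter X f kappa z0 w' k.
Proof.
elim: k => [//|k IHk ww'].
have E : SA_iter X f kappa z0 w k = SA_iter X f kappa z0 w' k.
  by apply: IHk => i ik; apply: ww'; rewrite ltnS ltnW.
by rewrite /= E (ww' k (ltnSn k)).
Qed.

Lemma SA_estimate_rcons k (t : k.-tuple (obs R n m)) (w : obs R n m) :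
  SA_estimate X f kappa z0 (rcons_tuple_pair (t, w)) =
  SA_step X f (stepsize kappa k.+1) (SA_estimate X f kappa z0 t) w.
Proof.
have wk : nth point (rcons t w) k = w by rewrite nth_rcons size_tuple ltnn eqxx.
rewrite /SA_estimate /= /SA_step wk.
rewrite (eq_SA_iter (w' := nth point t)) // => i ik.
by rewrite nth_rcons size_tuple ik.
Qed.

Lemma mmeasurable_SA_estimate k :
  mmeasurable (fun t : k.-tuple (obs R n m) => SA_estimate X f kappa z0 t).
Proof.
suff h j : (j <= k)%N -> mmeasurable (fun t : k.-tuple (obs R n m) =>
    SA_iter X f kappa z0 (nth point t) j) by exact: h.
elim: j => [_|j IHj jk]; first exact: mmeasurable_cst.
have mw : measurable_fun setT
    (fun t : k.-tuple (obs R n m) => nth point t j).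
  under eq_fun do rewrite -(tnth_nth point _ (Ordinal jk)).
  exact: measurable_tnth.
have meta : mmeasurable (fun t : k.-tuple (obs R n m) =>
    ((nth point t j).1 : 'M[R]_(n, m))).
  by move=> a b; exact: measurableT_comp (mmeasurable_fst a b) mw.
have my : mmeasurable (fun t : k.-tuple (obs R n m) =>
    ((nth point t j).2 : 'cV[R]_m)).
  by move=> a b; exact: measurableT_comp (mmeasurable_snd a b) mw.
have mz := IHj (ltnW jk).
apply: (mmeasurable_comp (continuous_Proj X0 Xconv Xcomp)).
apply: mmeasurableB => //; apply: mmeasurableZ; apply: mmeasurableB.
  exact: mmeasurable_field.
exact: mmeasurableM.
Qed.

End SA_iterates.

(** With [S = 4 M^2 / kappa^2] and [e <= S / (k + 1)], the left-hand side is at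
    most [(k / (k + 2)) (S / (k + 1)) + S / (k + 2)^2], which falls short of
    [S / (k + 2)] by [S / ((k + 1) (k + 2)^2)]. *)
Lemma SA_rate (R : realType) (e kappa M : R) (k : nat) : 0 < kappa ->
  e <= 4 * M ^+ 2 / (kappa ^+ 2 * (k%:R + 1)) ->
  (1 - 2 * kappa * stepsize kappa k.+1) * e +
    4 * stepsize kappa k.+1 ^+ 2 * M ^+ 2 <=
  4 * M ^+ 2 / (kappa ^+ 2 * (k.+1%:R + 1)).
Proof.
move=> kappa0; rewrite /stepsize -(natr1 k).
have : 0 <= k%:R :> R by exact: ler0n.
move: (k%:R) => r r0 he.
have M0 := sqr_ge0 M; move: (M ^+ 2) M0 he => M2 M0 he.
have -> : 1 - 2 * kappa * (kappa * (r + 1 + 1))^-1 = r / (r + 2).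
  by field; rewrite !gt_eqF //; lra.
have c0 : 0 <= r / (r + 2) by rewrite divr_ge0 //; lra.
apply: (@le_trans _ _ (r / (r + 2) * (4 * M2 / (kappa ^+ 2 * (r + 1))) +
  4 * ((kappa * (r + 1 + 1))^-1) ^+ 2 * M2)).
  by rewrite lerD2r ler_wpM2l.
rewrite -subr_ge0.
have -> : 4 * M2 / (kappa ^+ 2 * (r + 1 + 1)) -
  (r / (r + 2) * (4 * M2 / (kappa ^+ 2 * (r + 1))) +
   4 * ((kappa * (r + 1 + 1))^-1) ^+ 2 * M2) =
  4 * M2 / (kappa ^+ 2 * (r + 1) * (r + 2) ^+ 2).
  by field; rewrite !gt_eqF //; lra.
by rewrite divr_ge0 ?mulr_ge0 ?sqr_ge0 //; lra.
Qed.

Theorem proposition3p2 (R : realType) (m n : nat) (hm : (0 < m)%N)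
    (hn : (0 < n)%N) (X : set 'cV[R]_n) (f : 'cV[R]_m -> 'cV[R]_m)
    (P : 'cV[R]_n -> probability (obs R n m) R)
    (Q : probability (borelM R n m) R) (kappa M : R)
    (* generalized linear model *)
    (hQ : forall x, X x -> forall B : set (borelM R n m), measurable B ->
      P x (fst @^-1` B) = Q B)
    (hy : forall x, X x -> forall i : 'I_m,
      cond_expectation (P x) fst (fun w : obs R n m => (w.2 : 'cV[R]_m) i ord0)
        (fun eta : borelM R n m =>
           f ((eta : 'M[R]_(n, m))^T *m x) i ord0))
    (* A.1 *)
    (hfc : continuous f)
    (hfm : monotone_field f)
    (hF : forall (z : 'cV[R]_n) (i : 'I_n),
      Q.-integrable setT (fun eta : borelM R n m =>
        (((eta : 'M[R]_(n, m)) *m f ((eta : 'M[R]_(n, m))^T *m z)) i ord0)%:E))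
    (* A.2 *)
    (hX0 : X !=set0)
    (hXconv : convex_set (X : set (convex_lmodType 'cV[R]_n)))
    (hXcomp : compact X)
    (hkappa : 0 < kappa)
    (hFkappa : monotone_modulus kappa X (regression_field Q f))
    (* A.3 *)
    (hM : forall x, X x ->
      (\int[P x]_w
         (norm2 ((w.1 : 'M[R]_(n, m)) *m (w.2 : 'cV[R]_m)) ^+ 2)%:E
       <= (M ^+ 2)%:E)%E)
    (x : 'cV[R]_n) (hx : X x) (z0 : 'cV[R]_n) (hz0 : X z0) (k : nat) :
  (\int[power_prob (P x) k]_t
     (norm2 (SA_estimate X f kappa z0 t - x) ^+ 2)%:E
   <= (4 * M ^+ 2 / (kappa ^+ 2 * (k%:R + 1)))%:E)%E.
Proof.
pose z k (t : k.-tuple (obs R n m)) := SA_estimate X f kappa z0 t.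
pose err k (t : k.-tuple (obs R n m)) := dotp (z k t - x) (z k t - x).
have merr j : measurable_fun setT (err j).
  by apply: measurable_dotp; apply: mmeasurableB;
    (exact: mmeasurable_SA_estimate || exact: mmeasurable_cst).
have err0 j t : 0 <= err j t by exact: dotp_ge0.
rewrite [leLHS](_ : _ = \int[power_prob (P x) k]_t (err k t)%:E)%E; last first.
  by apply: eq_integral => t _; rewrite sqr_norm2.
elim: k => [|k IHk].
  (* The integrand is constant: [z_0] is deterministic. *)
  rewrite [leLHS](_ : _ = (dotp (z0 - x) (z0 - x))%:E).
    rewrite lee_fin add0r mulr1.
    exact: (dotp_diameter hQ hy hfc hF hM hkappa hFkappa).
  exact: (has_mean_integral
    (has_mean_cst (power_prob (P x) 0) (dotp (z0 - x) (z0 - x)))).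
have [r hr rk] := ge0_integral_has_mean (merr k) (err0 k) IHk.
pose gamma := stepsize kappa k.+1.
have gamma0 : 0 <= gamma.
  by rewrite invr_ge0 mulr_ge0 ?addr_ge0 ?ler0n // ltW.
have mE : measurable_fun setT (EFin \o err k.+1).
  by apply/measurable_EFinP; exact: merr.
have mErcons : measurable_fun setT
    (EFin \o err k.+1 \o @rcons_tuple_pair (obs R n m) k).
  exact: measurableT_comp mE (@measurable_rcons_tuple_pair _ _ k).
rewrite /= (ge0_integral_distribution _ mE); last first.
  by move=> t; rewrite lee_fin.
rewrite (fubini_tonelli1 _ mErcons); last by move=> p; rewrite lee_fin.
(* The one-step bound, integrated over the previous iterate. *)
have hB := has_meanD (has_meanZ (1 - 2 * kappa * gamma) hr)
  (has_mean_cst _ (4 * gamma ^+ 2 * M ^+ 2)).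
apply: (@le_trans _ _ (((1 - 2 * kappa * gamma) * r +
    4 * gamma ^+ 2 * M ^+ 2))%:E); last by rewrite lee_fin SA_rate.
rewrite -(has_mean_integral hB).
apply: ge0_le_integral => //.
- by move=> t _; apply: integral_ge0 => w _; rewrite lee_fin.
- apply: measurable_fun_fubini_tonelli_F => // p.
  by rewrite lee_fin.
- exact: measurable_int hB.1.
move=> t _; rewrite /fubini_F /err /=.
under eq_integral do rewrite /z SA_estimate_rcons.
apply: (integral_SA_step_le hQ hy hfc hF hM hFkappa) => //.
exact: SA_iter_in.
Qed.
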